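(* Let $k$ be a field of characteristic zero, $S=k[x,y,z]$, and let $I=(x^a,y^b,z^c,x^{\alpha}z^{\gamma},y^{\beta}z^{\gamma})$ where $a,b,c,\alpha,\beta,\gamma$ are integers with $0<\alpha<a$, $0<\beta<b$ and $0<\gamma<c$. Then $S/I$ has the strong Lefschetz property if any of the following conditions holds: (1) $\alpha+\beta-1\le a+b-c\le\alpha+\beta+1$; (2) $\min\{\alpha,\beta\}\ne\max\{\alpha,\beta\}=\min\{\alpha+\beta,a,b\}$ and $\max\{\alpha,\beta\}-\gamma-1\le a+b-c\le\max\{\alpha,\beta\}-\gamma+1$; (3) $\min\{\alpha,\beta\}<\max\{\alpha,\beta\}\le 2$ and $a+b+\gamma\le c+2$.
   Context: $S$ is standard graded. A graded Artinian $k$-algebra $A=S/I$ has the strong Lefschetz property if there exists a linear form $\ell\in A_1$ such that the multiplication map $\times\ell^d\colon A_i\to A_{i+d}$ has maximal rank (is injective or surjective) for all $d>0$ and all $i$. *)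

(* Defs.v *)
From HB Require Import structures.
From mathcomp Require Import all_boot all_order all_algebra.
From mathcomp Require Import mpoly.
Set Implicit Arguments. Unset Strict Implicit. Unset Printing Implicit Defensive.
Import Order.TTheory GRing.Theory Num.Theory.
Local Open Scope ring_scope.

Definition in_ideal (k : fieldType) (n : nat) (gs : seq {mpoly k[n]})
  (p : {mpoly k[n]}) : Prop :=
  exists cs : seq {mpoly k[n]},
    size cs = size gs /\ p = \sum_(j < size gs) cs`_j * gs`_j.

(* For a homogeneous ideal I and A = S/I, the graded piece A_i is S_i / I_i.
   [mult_max_rank I l d i] says the map  x l^d : A_i -> A_{i+d},
   [f] |-> [l^d f], is injective or surjective. *)
Definition mult_injective (k : fieldType) (n : nat) (I : {mpoly k[n]} -> Prop)
  (l : {mpoly k[n]}) (d i : nat) : Prop :=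
  forall f : {mpoly k[n]}, f \is i.-homog -> I (l ^+ d * f) -> I f.

Definition mult_surjective (k : fieldType) (n : nat) (I : {mpoly k[n]} -> Prop)
  (l : {mpoly k[n]}) (d i : nat) : Prop :=
  forall g : {mpoly k[n]}, g \is (i + d)%N.-homog ->
    exists2 f : {mpoly k[n]}, f \is i.-homog & I (g - l ^+ d * f).

Definition mult_max_rank (k : fieldType) (n : nat) (I : {mpoly k[n]} -> Prop)
  (l : {mpoly k[n]}) (d i : nat) : Prop :=
  mult_injective I l d i \/ mult_surjective I l d i.

(* Strong Lefschetz property of S/I (I homogeneous, S/I Artinian):
   some linear form l (an element of A_1, represented by a degree-1
   homogeneous polynomial) such that x l^d : A_i -> A_{i+d} has maximal rank
   for all d > 0 and all i. *)
Definition has_SLP (k : fieldType) (n : nat) (I : {mpoly k[n]} -> Prop) : Prop :=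
  exists2 l : {mpoly k[n]}, l \is 1%N.-homog &
    forall d i : nat, (0 < d)%N -> mult_max_rank I l d i.

Definition I_gens (k : fieldType) (a b c al be ga : nat) : seq {mpoly k[3]} :=
  [:: 'X_0 ^+ a; 'X_1 ^+ b; 'X_2 ^+ c;
      'X_0 ^+ al * 'X_2 ^+ ga; 'X_1 ^+ be * 'X_2 ^+ ga].

(* Main.v *)
(* For a monomial complete intersection k[x_1..x_n]/(x_j^(e_j+1)), the product by
   l = x_1 + ... + x_n is the raising operator of an sl_2-action, whose lowering
   operator preserves the ideal; hence in characteristic 0 the map l^d from
   degree i is injective if 2i + d <= e_1 + ... + e_n, and surjective if >=.  The
   same holds for the span of any interval [u, w] of monomials, with threshold
   |u| + |w|, since this is a shift by x^u of such an algebra.  The monomials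
   outside I split into few intervals compatible with a filtration by monomial
   ideals, so l^d is injective (surjective) as soon as it is so on each of them:
   - z < ga and z >= ga, with thresholds a + b + ga - 3, al + be + c + ga - 3;
   - {x < al, y < be}, {x < al, y >= be, z < ga}, {x >= al, z < ga}, with
     thresholds al + be + c - 3, al + be + b + ga - 3, al + a + b + ga - 3;
   - the latter with x and y exchanged.
   Under (1) the thresholds of the first splitting differ by at most 1, and under
   (2) so do those of the second or third, so every l^d has maximal rank.  Under
   (3) the first splitting gives injectivity below a + b + ga - 3, and the others
   give surjectivity above it, except in degree i = 0, which is direct. *)
Require Import Defs.
From HB Require Import structures.
From mathcomp Require Import all_boot all_order all_algebra.
From mathcomp Require Import mpoly.
From mathcomp Require Import zify ring.
Import Order.TTheory GRing.Theory Num.Theory.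
Local Open Scope ring_scope.

(** * Vanishing on sets of monomials, and homogeneity *)

Section MonomialLefschetz.
Set Implicit Arguments.
Unset Strict Implicit.
Context {k : fieldType} {n : nat}.
Implicit Types (f g h : {mpoly k[n]}) (m u w e : 'X_{1..n}) (D E : pred 'X_{1..n}).

(** For down-closed [D] this is membership in the monomial ideal spanned by the monomials outside
    [D]. *)
Definition vanishes_on D f : Prop := forall m, D m -> f@_m = 0.

Definition down_closed D : Prop := forall m u, (u <= m)%MM -> D m -> D u.

Definition sum_vars : {mpoly k[n]} := \sum_(j < n) 'X_j.

Lemma vanishes_on0 D : vanishes_on D 0.
Proof. by move=> m _; rewrite mcoeff0. Qed.

Lemma vanishes_onD D f g :
  vanishes_on D f -> vanishes_on D g -> vanishes_on D (f + g).
Proof. by move=> hf hg m Dm; rewrite mcoeffD hf // hg // addr0. Qed.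

Lemma vanishes_onB D f g :
  vanishes_on D f -> vanishes_on D g -> vanishes_on D (f - g).
Proof. by move=> hf hg m Dm; rewrite mcoeffB hf // hg // subr0. Qed.

Lemma vanishes_onZ D c f : vanishes_on D f -> vanishes_on D (c *: f).
Proof. by move=> hf m Dm; rewrite mcoeffZ hf // mulr0. Qed.

Lemma vanishes_on_scale D c f :
  c != 0 -> vanishes_on D (c *: f) -> vanishes_on D f.
Proof.
move=> c0 hf m Dm; move: (hf m Dm); rewrite mcoeffZ => /eqP.
by rewrite mulf_eq0 (negPf c0) => /eqP.
Qed.

Lemma mcoeffM_eq0 h f m :
  (forall u, (u <= m)%MM -> f@_u = 0) -> (h * f)@_m = 0.
Proof.
move=> hf; rewrite mcoeffM big1 // => -[u v] /= /eqP def_m.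
by rewrite [f@_v]hf ?mulr0 // [X in (_ <= X)%MM]def_m lem_addl.
Qed.

Lemma vanishes_onM D h f :
  down_closed D -> vanishes_on D f -> vanishes_on D (h * f).
Proof.
move=> dD hf m Dm; apply: mcoeffM_eq0 => u le_um; apply: hf; exact: dD Dm.
Qed.

Lemma homog_sum_vars : sum_vars \is 1.-homog.
Proof. by apply: rpred_sum => j _; rewrite dhomogX; apply/eqP/mdeg1. Qed.

Lemma homog_sum_varsX d i f :
  f \is i.-homog -> sum_vars ^+ d * f \is (i + d)%N.-homog.
Proof.
move=> hf; rewrite addnC; apply: dhomogM => //.
by have := dhomogMn d homog_sum_vars; rewrite mul1n.
Qed.

Lemma homog_mcoeff i f m : f \is i.-homog -> f@_m != 0 -> mdeg m = i.
Proof. by move=> /dhomogP hf; rewrite -mcoeff_msupp => /hf. Qed.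

Lemma homog_by_mcoeff i f :
  (forall m, f@_m != 0 -> mdeg m = i) -> f \is i.-homog.
Proof. by move=> hf; apply/dhomogP => m; rewrite mcoeff_msupp => /hf. Qed.

(** * The lowering operator and its commutation relations *)

Lemma mcoeff_euler j f m : ('X_j * f^`M(j))@_m = f@_m *+ m j.
Proof.
elim/mpolyind: f => [|c u f _ _ IH]; first by rewrite mderiv0 mulr0 mcoeff0 mul0rn.
rewrite mderivD mulrDr !mcoeffD IH mulrnDl; congr (_ + _).
rewrite mderivZ mderivX -!scalerAr !mcoeffZ -mpolyXD.
case: (posnP (u j)) => [u0|u_gt0].
  rewrite u0 mul0r mulr0 mcoeffX.
  by case: eqP => [<-|_]; rewrite ?u0 ?mulr0n // mulr0 mul0rn.
rewrite addmC submK; last first.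
  by apply/mnm_lepP => a; rewrite mnm1E; case: eqP => [<-|].
by rewrite mcoeffX; case: eqP => [->|_]; rewrite ?mulr1 ?mulr0 ?mul0rn // mulr_natr.
Qed.

(* The lowering operator of the sl_2-triple acting on k[x_1]/(x_1^(e_1+1)) (x)
   ... (x) k[x_n]/(x_n^(e_n+1)), whose raising operator is the product by the
   sum of the variables. *)
Definition lowering e f : {mpoly k[n]} :=
  \sum_(j < n) ((e j)%:R *: f^`M(j) - 'X_j * f^`M(j)^`M(j)).

Lemma mcoeff_lowering e f m :
  (lowering e f)@_m =
  \sum_(j < n) ((e j)%:R - (m j)%:R) * (f@_(m + U_(j)) *+ (m j).+1).
Proof.
rewrite raddf_sum; apply: eq_bigr => j _ /=.
by rewrite mcoeffB mcoeffZ mcoeff_euler mcoeff_mderiv mulrBl !mulr_natl.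
Qed.

(** At [m] in the box, a coefficient of [f] from outside the box enters only through [m + U_(j)]
    with [m j = e j], where its factor [e j - m j] is zero. *)
Lemma vanishes_on_lowering e f :
  vanishes_on (fun m => m <= e)%MM f ->
  vanishes_on (fun m => m <= e)%MM (lowering e f).
Proof.
move=> hf m /mnm_lepP le_me; rewrite mcoeff_lowering big1 // => j _.
case: (eqVneq (m j) (e j)) => [->|ne_me]; first by rewrite subrr mul0r.
rewrite hf ?mul0rn ?mulr0 //; apply/mnm_lepP => a; rewrite mnmDE mnm1E.
have := le_me a; have := le_me j; case: eqP => [<-|]; lia.
Qed.

Lemma homog_lowering e i f :
  f \is i.+1.-homog -> lowering e f \is i.-homog.
Proof.
move=> hf; apply: homog_by_mcoeff => m; rewrite mcoeff_lowering => nz.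
apply/eqP; apply: contraNT nz => ne; apply/eqP; rewrite big1 // => j _.
rewrite (dhomog_nemf_coeff hf) ?mul0rn ?mulr0 //.
by rewrite /= mdegD mdeg1 addn1 eqSS.
Qed.

Lemma lowering_homog0 e f : f \is 0.-homog -> lowering e f = 0.
Proof.
move=> hf; apply/mpolyP => m; rewrite mcoeff_lowering mcoeff0 big1 // => j _.
by rewrite (dhomog_nemf_coeff hf) ?mul0rn ?mulr0 //= mdegD mdeg1 addn1.
Qed.

Lemma euler_homog i f :
  f \is i.-homog -> \sum_(j < n) 'X_j * f^`M(j) = i%:R *: f.
Proof.
move=> hf; apply/mpolyP => m; rewrite raddf_sum mcoeffZ /=.
under eq_bigr do rewrite mcoeff_euler -mulr_natl.
rewrite -mulr_suml -natr_sum -mdegE.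
case: (eqVneq f@_m 0) => [->|nz]; first by rewrite !mulr0.
by rewrite (homog_mcoeff hf nz).
Qed.

Lemma mderiv_sum_vars j : sum_vars^`M(j) = 1.
Proof.
rewrite raddf_sum (bigD1 j) //= mderivX mnm1E eqxx scale1r -{1}[U_(j)%MM]add0m addmK mpolyX0.
rewrite big1 ?addr0 // => a ne_aj; rewrite mderivX mnm1E (negPf ne_aj) scale0r //.
Qed.

(** The sl_2 relation: by the Leibniz rule the extra terms are [e j * f - 2 x_j d_j f], and Euler's
    identity sums them to the weight [mdeg e - 2i] times [f]. *)
Lemma lowering_sum_vars e i f : f \is i.-homog ->
  lowering e (sum_vars * f) =
  sum_vars * lowering e f + ((mdeg e)%:R - i%:R *+ 2) *: f.
Proof.
move=> hf; rewrite scalerBl -[in X in _ - X]scalerMnl -(euler_homog hf) mdegE natr_sum.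
rewrite scaler_suml mulr_sumr -sumrMnl -sumrB -big_split /=.
apply: eq_bigr => j _; rewrite !(mderivM, mderivD, mderiv_sum_vars, mul1r).
rewrite -!mul_mpolyC; ring.
Qed.

(** Iterating adds up the weights [mdeg e - 2(i + t)] for [t = 0..d]. *)
Lemma lowering_sum_varsX e i d f : f \is i.-homog ->
  lowering e (sum_vars ^+ d.+1 * f) =
  sum_vars ^+ d.+1 * lowering e f +
  (d.+1%:R * ((mdeg e)%:R - i%:R *+ 2 - d%:R)) *: (sum_vars ^+ d * f).
Proof.
move=> hf; elim: d => [|d IH].
  by rewrite !expr1 expr0 mul1r (lowering_sum_vars _ hf) subr0 mul1r.
rewrite exprS -mulrA (lowering_sum_vars _ (homog_sum_varsX d.+1 hf)) IH.
by rewrite -!mul_mpolyC !exprS; ring.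
Qed.

(** * Lefschetz thresholds of a box in characteristic zero *)

Context (char0 : [pchar k] =i pred0).

Lemma natf_char0 d : (d%:R == 0 :> k) = (d == 0)%N.
Proof. by move/pcharf0P: char0 => ->. Qed.

Lemma lowering_coef_neq0 N i d : N != (i.*2 + d)%N ->
  d.+1%:R * (N%:R - i%:R *+ 2 - d%:R) != 0 :> k.
Proof.
move=> neN; rewrite mulf_neq0 ?natf_char0 // -[i%:R *+ 2]mulr_natr -natrM muln2.
rewrite -addrA -opprD -natrD; case: (leqP (i.*2 + d) N) => [le|/ltnW le].
  by rewrite -natrB // natf_char0; lia.
by rewrite -oppr_eq0 opprB -natrB // natf_char0; lia.
Qed.

Lemma down_closed_box e : down_closed (fun m => m <= e)%MM.
Proof. by move=> m u le_um le_me; apply: lepm_trans le_me. Qed.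

(** Write s for [sum_vars], F for [lowering e], and work modulo the box ideal. If s^(d+1) f = 0,
    applying F gives s^(d+1) F f + c s^d f = 0. Once F f = 0 is known, s^d f = 0 follows, and the
    induction on [d] concludes. *)
Lemma box_injective e i d f : f \is i.-homog -> (i.*2 + d <= mdeg e)%N ->
  vanishes_on (fun m => m <= e)%MM (sum_vars ^+ d * f) ->
  vanishes_on (fun m => m <= e)%MM f.
Proof.
elim/ltn_ind: i d f => i IHi d f hf.
elim: d => [|d IHd] le_N van; first by rewrite expr0 mul1r in van.
apply: IHd; [lia|].
pose c : k := d.+1%:R * ((mdeg e)%:R - i%:R *+ 2 - d%:R).
have c_nz : c != 0 by apply: lowering_coef_neq0; lia.
apply: (vanishes_on_scale c_nz).
have /vanishes_on_lowering low := van.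
rewrite (lowering_sum_varsX e d hf) -/c in low.
suff low0 : vanishes_on (fun m => m <= e)%MM (lowering e f).
  rewrite -[_ *: _](addKr (sum_vars ^+ d.+1 * lowering e f)) addrC.
  by apply: (vanishes_onB low); apply: (vanishes_onM _ (@down_closed_box e)).
case: i => [|i] in IHi hf le_N c c_nz low *.
  by rewrite lowering_homog0 //; apply: vanishes_on0.
(* Multiplying the relation by s gives s^(d+2) F f = - c s^(d+1) f = 0, so induction applies to F f,
   one degree lower. *)
apply: (IHi i (ltnSn i) d.+2); [exact: homog_lowering|lia|].
have -> : sum_vars ^+ d.+2 * lowering e f =
  sum_vars * (sum_vars ^+ d.+1 * lowering e f + c *: (sum_vars ^+ d * f)) -
  c *: (sum_vars ^+ d.+1 * f) by rewrite -!mul_mpolyC !exprS; ring.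
apply: vanishes_onB; last exact: vanishes_onZ.
by apply: (vanishes_onM _ (@down_closed_box e)).
Qed.

(** Outer induction on the distance of the target degree [i + d] to the top, inner on [d]. Modulo
    the box ideal, g = s^d h and s g = s^(d+2) h2. Applying F to s^(d+1) h = s^(d+2) h2 and solving
    for c s^d h shows that c g is a multiple of s^(d+1). *)
Lemma box_surjective e i d g : g \is (i + d)%N.-homog ->
  (mdeg e <= i.*2 + d)%N ->
  exists2 f, f \is i.-homog &
    vanishes_on (fun m => m <= e)%MM (g - sum_vars ^+ d * f).
Proof.
move: {2}((mdeg e).+1 - (i + d)).+1%N (ltnSn ((mdeg e).+1 - (i + d))) => s.
elim: s i d g => // s IHs i d; elim: d i => [|d IHd] i g lt_s hg le_N.
  by exists g; [rewrite addn0 in hg | rewrite expr0 mul1r subrr; apply: vanishes_on0].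
case: (leqP (i + d.+1) (mdeg e)) => [le_e|gt_e]; last first.
  (* Past degree [mdeg e] the box has no monomials. *)
  exists 0; first exact: dhomog0.
  move=> m /mnm_lepP le_me; rewrite mulr0 subr0 (dhomog_nemf_coeff hg) //.
  have : (mdeg m <= mdeg e)%N by rewrite !mdegE; apply: leq_sum => j _.
  by rewrite /=; lia.
have [|||h hh van_h] := IHd i.+1 g; [lia| by rewrite addSnnS |lia|].
have [|||h2 hh2 van_h2] := IHs i d.+2 (sum_vars * g); [lia| |lia|].
  by rewrite -[sum_vars]expr1 -[d.+2]addn1 addnA; apply: homog_sum_varsX.
set c : k := d.+1%:R * ((mdeg e)%:R - i.+1%:R *+ 2 - d%:R).
have c_nz : c != 0 by apply: lowering_coef_neq0; lia.
pose c2 : k := d.+2%:R * ((mdeg e)%:R - i%:R *+ 2 - d.+1%:R).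
pose f := sum_vars * lowering e h2 + c2 *: h2 - lowering e h.
exists (c^-1 *: f).
  apply: dhomogZ; apply: rpredB; last exact: homog_lowering.
  apply: rpredD; last exact: dhomogZ.
  case: (i) hh2 => [|i'] hh2; first by rewrite lowering_homog0 // mulr0 dhomog0.
  rewrite -[sum_vars]expr1 -[i'.+1]addn1; apply: homog_sum_varsX; exact: homog_lowering.
apply: (vanishes_on_scale c_nz).
have lowD p q : lowering e (p - q) = lowering e p - lowering e q.
  by apply/mpolyP => m; rewrite mcoeffB !mcoeff_lowering -sumrB;
     apply: eq_bigr => j _; rewrite mcoeffB mulrnBl mulrBr.
have v1 := vanishes_on_lowering van_h2.
have v2 : vanishes_on (fun m => m <= e)%MM
    (lowering e (sum_vars * (g - sum_vars ^+ d * h))).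
  by apply: vanishes_on_lowering; apply: (vanishes_onM _ (@down_closed_box e)).
have v3 := vanishes_onZ c van_h.
rewrite mulrBr mulrA -exprS in v2; rewrite !lowD in v1 v2.
rewrite (lowering_sum_varsX e d hh) -/c in v2.
rewrite (lowering_sum_varsX e d.+1 hh2) -/c2 in v1.
have -> : c *: (g - sum_vars ^+ d.+1 * (c^-1 *: f)) =
   c *: g - sum_vars ^+ d.+1 * f.
  by rewrite scalerBr scalerAr scalerA divff // scale1r.
move: (vanishes_onD (vanishes_onB v1 v2) v3); congr (vanishes_on _ _).
rewrite /f !scalerBr -!mul_mpolyC !exprS; ring.
Qed.

(** * Filtrations by sets of monomials *)

Definition trunc D f : {mpoly k[n]} := \sum_(m <- msupp f | D m) f@_m *: 'X_[m].

Lemma mcoeff_trunc D f m : (trunc D f)@_m = if D m then f@_m else 0.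
Proof.
rewrite raddf_sum /=; under eq_bigr do rewrite mcoeffZ mcoeffX.
case: (boolP (m \in msupp f)) => [m_f|/memN_msupp_eq0 f_m0].
  rewrite big_mkcond (bigD1_seq m) ?msupp_uniq //= eqxx mulr1 big1 ?addr0 // => u ne_um.
  by rewrite (negPf ne_um) mulr0; case: ifP.
rewrite f_m0 if_same big1 // => u _.
by case: eqP => [->|_]; rewrite ?f_m0 ?mul0r ?mulr0.
Qed.

Lemma homog_trunc D i f : f \is i.-homog -> trunc D f \is i.-homog.
Proof.
move=> hf; apply: homog_by_mcoeff => m; rewrite mcoeff_trunc.
by case: ifP => [_|]; [apply: homog_mcoeff | rewrite eqxx].
Qed.

Lemma trunc_supp D f : vanishes_on (predC D) (trunc D f).
Proof. by move=> m /= /negPf Dm; rewrite mcoeff_trunc Dm. Qed.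

Lemma vanishes_on_truncB D f : vanishes_on D (f - trunc D f).
Proof. by move=> m Dm; rewrite mcoeffB mcoeff_trunc Dm subrr. Qed.

Lemma vanishes_onM_above D E h f :
  (forall m u, D m -> E u -> ~~ (u <= m)%MM) ->
  vanishes_on (predC E) f -> vanishes_on D (h * f).
Proof.
move=> DE hf m Dm; apply: mcoeffM_eq0 => u le_um; apply: hf => /=.
by apply/negP => Eu; have /negP := DE m u Dm Eu.
Qed.

(* For a convex set D of monomials, the k-module spanned by D is a subquotient
   of the polynomial ring by monomial ideals, and the next two properties say
   that the d-th power of the sum of the variables is injective (surjective)
   from its degree i part to its degree i + d part. *)
Definition injective_on D i d : Prop := forall f, f \is i.-homog ->
  vanishes_on (predC D) f -> vanishes_on D (sum_vars ^+ d * f) -> f = 0.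

Definition surjective_on D i d : Prop := forall g, g \is (i + d)%N.-homog ->
  vanishes_on (predC D) g ->
  exists f, [/\ f \is i.-homog, vanishes_on (predC D) f &
                vanishes_on D (g - sum_vars ^+ d * f)].

Lemma eq0_homog_supp D i f : (forall m, D m -> mdeg m != i) ->
  f \is i.-homog -> vanishes_on (predC D) f -> f = 0.
Proof.
move=> Di hf van; apply/mpolyP => m; rewrite mcoeff0.
have [/Di ne|nDm] := boolP (D m); last exact: van.
exact: dhomog_nemf_coeff hf ne.
Qed.

Lemma injective_on_deg D i d :
  (forall m, D m -> mdeg m != i) -> injective_on D i d.
Proof. by move=> Di f hf van _; apply: eq0_homog_supp Di hf van. Qed.

(** Only degree [i + d] matters in the target, and a preimage supported in [E] is also supported in
    [D]. *)
Lemma surjective_on_sub D E i d : (forall m, E m -> D m) ->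
  (forall m, mdeg m = (i + d)%N -> D m -> E m) ->
  surjective_on E i d -> surjective_on D i d.
Proof.
move=> ED DE surjE g hg van_g.
have [|f [hf van_f van]] := surjE g hg.
  move=> m /= nEm; have [/eqP deg_m|ne] := boolP (mdeg m == (i + d)%N).
    by apply: van_g => /=; apply: contra nEm; apply: DE.
  exact: dhomog_nemf_coeff hg ne.
exists f; split=> // m Dm.
  by apply: van_f => /=; apply: contra Dm; apply: ED.
have [/eqP deg_m|ne] := boolP (mdeg m == (i + d)%N); first exact/van/DE.
apply: dhomog_nemf_coeff ne; apply: rpredB => //; exact: homog_sum_varsX.
Qed.

(** No monomial of [E1] is a multiple of one of [E2], so [E2] spans a submodule with quotient [E1].
    The [E1] part of a kernel element dies first, then the rest. *)
Lemma injective_onU D E1 E2 i d : D =1 predU E1 E2 ->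
  (forall m u, E1 m -> E2 u -> ~~ (u <= m)%MM) ->
  injective_on E1 i d -> injective_on E2 i d -> injective_on D i d.
Proof.
move=> DE E12 inj1 inj2 f hf van_f van.
have f2_supp : vanishes_on (predC E2) (f - trunc E1 f).
  move=> m /= nE2m; rewrite mcoeffB mcoeff_trunc.
  case: ifP => [|nE1m]; first by rewrite subrr.
  by rewrite subr0 van_f //= DE /= nE1m.
have f1_0 : trunc E1 f = 0.
  apply: inj1; [exact: homog_trunc | exact: trunc_supp|].
  have -> : sum_vars ^+ d * trunc E1 f =
    sum_vars ^+ d * f - sum_vars ^+ d * (f - trunc E1 f) by ring.
  apply: vanishes_onB; last exact: vanishes_onM_above f2_supp.
  by move=> m E1m; apply: van; rewrite DE /= E1m.
rewrite f1_0 subr0 in f2_supp; apply: inj2 => // m E2m.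
by apply: van; rewrite DE /= E2m orbT.
Qed.

(** A preimage of the [E1] part is chosen first; the error it leaves on [E2] is then corrected
    without disturbing [E1]. *)
Lemma surjective_onU D E1 E2 i d : D =1 predU E1 E2 ->
  (forall m u, E1 m -> E2 u -> ~~ (u <= m)%MM) ->
  surjective_on E1 i d -> surjective_on E2 i d -> surjective_on D i d.
Proof.
move=> DE E12 surj1 surj2 g hg van_g.
have [f1 [hf1 supp1 van1]] :=
  surj1 _ (homog_trunc E1 hg) (@trunc_supp E1 g).
have hg2 : g - sum_vars ^+ d * f1 \is (i + d)%N.-homog.
  by apply: rpredB => //; apply: homog_sum_varsX.
have [f2 [hf2 supp2 van2]] := surj2 _ (homog_trunc E2 hg2) (@trunc_supp E2 _).
exists (f1 + f2); split; first exact: rpredD.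
  move=> m; rewrite /= DE /= negb_or => /andP[nE1 nE2].
  by rewrite mcoeffD supp1 // supp2 // addr0.
move=> m; rewrite DE => /orP[E1m|E2m].
  have -> : g - sum_vars ^+ d * (f1 + f2) = (g - trunc E1 g) +
    (trunc E1 g - sum_vars ^+ d * f1) - sum_vars ^+ d * f2 by ring.
  rewrite mcoeffB mcoeffD vanishes_on_truncB // van1 // add0r.
  by rewrite (vanishes_onM_above _ E12 supp2) ?subr0.
set g2 := g - _ in van2 hg2.
have -> : g - sum_vars ^+ d * (f1 + f2) = (g2 - trunc E2 g2) +
  (trunc E2 g2 - sum_vars ^+ d * f2) by rewrite /g2; ring.
by rewrite mcoeffD vanishes_on_truncB // van2 // addr0.
Qed.

(** * Intervals as shifted boxes *)

Definition interval u w : pred 'X_{1..n} := fun m => (u <= m)%MM && (m <= w)%MM.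

Lemma mdeg_le u w : (u <= w)%MM -> (mdeg u <= mdeg w)%N.
Proof. by move=> /mnm_lepP le; rewrite !mdegE; apply: leq_sum. Qed.

Lemma mdeg_subm u w : (u <= w)%MM -> mdeg (w - u) = (mdeg w - mdeg u)%N.
Proof. by move=> /submK {2}<-; rewrite mdegD addnK. Qed.

Lemma factor_monomial u i f : f \is i.-homog ->
  (forall m, f@_m != 0 -> (u <= m)%MM) ->
  exists2 g, g \is (i - mdeg u)%N.-homog & f = g * 'X_[u].
Proof.
move=> hf le_uf; exists (\sum_(m <- msupp f) f@_m *: 'X_[m - u]).
  rewrite big_seq; apply: rpred_sum => m m_f; apply: dhomogZ; rewrite dhomogX.
  apply/eqP; rewrite /= mdeg_subm; first by rewrite (dhomog_mf hf m_f).
  by apply: le_uf; rewrite -mcoeff_msupp.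
rewrite {1}[f]mpolyE big_seq [in RHS]big_seq mulr_suml; apply: eq_bigr => m m_f.
by rewrite -scalerAl -mpolyXD submK // le_uf // -mcoeff_msupp.
Qed.

Lemma mcoeffMX_eq0 g u m : ~~ (u <= m)%MM -> (g * 'X_[u])@_m = 0.
Proof.
move=> nle; apply: mcoeffM_eq0 => v le_vm; rewrite mcoeffX.
by case: eqP => // uv; rewrite uv le_vm in nle.
Qed.

Lemma mcoeffMX_sub g u m : (u <= m)%MM -> (g * 'X_[u])@_m = g@_(m - u).
Proof. by move=> /submK {1}<-; rewrite addmC mcoeffMX. Qed.

Lemma interval_add u w m : (u <= w)%MM -> (m <= w - u)%MM -> interval u w (m + u)%MM.
Proof.
move=> /mnm_lepP le_uw /mnm_lepP le_m; rewrite /interval lem_addl.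
apply/mnm_lepP => j; have := le_m j; have := le_uw j; rewrite !mnmE; lia.
Qed.

Lemma interval_sub u w m : interval u w m -> (m - u <= w - u)%MM.
Proof.
move=> /andP[_ /mnm_lepP le_m]; apply/mnm_lepP => j; have := le_m j.
rewrite !mnmE; lia.
Qed.

(** Division by ['X_[u]] leads to the box [w - u] in degree [i - mdeg u], where the box threshold
    becomes [mdeg u + mdeg w]. *)
Lemma interval_injective u w i d : (u <= w)%MM ->
  (i.*2 + d <= mdeg u + mdeg w)%N -> injective_on (interval u w) i d.
Proof.
move=> le_uw le_deg; have le_deg_uw := mdeg_le le_uw.
have [lt_iu|le_ui] := ltnP i (mdeg u).
  by apply: injective_on_deg => m /andP[/mdeg_le le_um _]; lia.
move=> f hf supp_f van.
have [|g hg def_f] := @factor_monomial u i f hf.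
  move=> m; apply: contraR => nle; rewrite supp_f //=.
  by rewrite /interval (negPf nle).
have van_g : vanishes_on (fun m => m <= w - u)%MM g.
  apply: (box_injective hg (d := d)); first by rewrite mdeg_subm //; lia.
  move=> m /(interval_add le_uw) /van; rewrite def_f mulrA.
  by rewrite mcoeffMX_sub ?lem_addl // addmK.
apply/mpolyP => m; rewrite mcoeff0.
have [uwm|] := boolP (interval u w m); last exact: supp_f.
rewrite def_f mcoeffMX_sub; first exact/van_g/interval_sub.
by case/andP: uwm.
Qed.

Lemma interval_surjective u w i d : (u <= w)%MM ->
  (mdeg u + mdeg w <= i.*2 + d)%N -> surjective_on (interval u w) i d.
Proof.
move=> le_uw le_deg g hg supp_g; have le_deg_uw := mdeg_le le_uw.
have [lt_iu|le_ui] := ltnP i (mdeg u).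
  (* Here [i < mdeg u] forces [i + d > mdeg w], so the target is zero. *)
  have -> : g = 0.
    apply: eq0_homog_supp hg supp_g => m /andP[_ /mdeg_le le_mw]; lia.
  exists 0; split; [exact: dhomog0 | exact: vanishes_on0 |].
  by rewrite mulr0 subr0; apply: vanishes_on0.
have [|g' hg' def_g] := @factor_monomial u _ g hg.
  move=> m; apply: contraR => nle; rewrite supp_g //=.
  by rewrite /interval (negPf nle).
have {hg'} hg' : g' \is (i - mdeg u + d)%N.-homog by rewrite addnBAC.
have [|f' hf' van] := @box_surjective (w - u)%MM _ _ g' hg'.
  by rewrite mdeg_subm //; lia.
set B := fun m => (m <= w - u)%MM in van.
(* Truncation puts the preimage inside the interval and changes it only by an element of the box
   ideal. *)
exists (trunc B f' * 'X_[u]); split.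
- rewrite -[i](subnK le_ui); apply: dhomogM; first exact: homog_trunc.
  by rewrite dhomogX.
- move=> m /= nuwm; have [le_um|nle] := boolP (u <= m)%MM; last exact: mcoeffMX_eq0.
  rewrite mcoeffMX_sub // trunc_supp //=; apply: contra nuwm => Bm.
  by rewrite -(submK le_um); apply: interval_add.
move=> m uwm; rewrite def_g mulrA -mulrBl mcoeffMX_sub; last by case/andP: uwm.
suff van' : vanishes_on B (g' - sum_vars ^+ d * trunc B f').
  exact/van'/interval_sub.
have -> : g' - sum_vars ^+ d * trunc B f' = (g' - sum_vars ^+ d * f') +
  sum_vars ^+ d * (f' - trunc B f') by ring.
apply: vanishes_onD => //; apply: vanishes_onM.
  exact: down_closed_box.
exact: vanishes_on_truncB.
Qed.

(** * Monomial ideals and their quotients *)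

Lemma in_ideal_monomials (us : seq 'X_{1..n}) f :
  in_ideal [seq 'X_[u] | u <- us] f <->
  vanishes_on (fun m => all (fun u => ~~ (u <= m)%MM) us) f.
Proof.
split=> [[cs [_ ->]] m /allP nle|van].
  rewrite raddf_sum big1 //= => j _; have lt_j : (j < size us)%N by rewrite -(size_map (fun u => 'X_[u] : {mpoly k[n]})).
  by rewrite (nth_map 0%MM) // mcoeffMX_eq0 // nle // mem_nth.
(* Each monomial of [f] is charged to the first generator dividing it; [c j] collects the quotients
   for generator [j]. *)
pose ix m := find (fun u => (u <= m)%MM) us.
pose c j := \sum_(m <- msupp f | ix m == j) f@_m *: 'X_[m - nth 0%MM us j] : {mpoly k[n]}.
exists (mkseq c (size us)); rewrite size_map size_mkseq; split=> //.
under eq_bigr => j _ do rewrite nth_mkseq // (nth_map 0%MM) // mulr_suml.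
rewrite {1}[f]mpolyE; under [in RHS]eq_bigr => j _ do rewrite big_mkcond.
rewrite exchange_big big_seq [in RHS]big_seq; apply: eq_bigr => m m_f /=.
have has_m : has (fun u => (u <= m)%MM) us.
  rewrite mcoeff_msupp in m_f; apply: contraR m_f; rewrite -all_predC => all_m.
  by rewrite van.
have lt_ix : (ix m < size us)%N by rewrite -has_find.
rewrite (bigD1 (Ordinal lt_ix)) //= eqxx big1 ?addr0.
  by rewrite -scalerAl -mpolyXD submK // (nth_find 0%MM has_m).
by move=> j; case: (ix m =P j) => // def_j /eqP[]; apply/val_inj.
Qed.

(** Each class modulo [I] has a unique representative supported on [D], obtained by [trunc]. *)
Lemma max_rank_of_span (I : {mpoly k[n]} -> Prop) D i d :
  (forall f, I f <-> vanishes_on D f) -> down_closed D ->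
  injective_on D i d \/ surjective_on D i d ->
  mult_max_rank I sum_vars d i.
Proof.
move=> ID dD [injD|surjD]; [left => f hf|right => g hg].
  move=> /ID van; apply/ID.
  rewrite -[f](subrK (trunc D f)) [X in _ + X]injD ?addr0.
  - exact: vanishes_on_truncB.
  - exact: homog_trunc.
  - exact: trunc_supp.
  have -> : sum_vars ^+ d * trunc D f =
    sum_vars ^+ d * f - sum_vars ^+ d * (f - trunc D f) by ring.
  apply: vanishes_onB => //; apply: vanishes_onM => //; exact: vanishes_on_truncB.
have [f [hf _ van]] := surjD _ (homog_trunc D hg) (@trunc_supp D g).
exists f => //; apply/ID.
have -> : g - sum_vars ^+ d * f = (g - trunc D g) +
  (trunc D g - sum_vars ^+ d * f) by ring.
by apply: vanishes_onD => //; apply: vanishes_on_truncB.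
Qed.

End MonomialLefschetz.

(** * Exponents in three variables and the monomials outside the ideal *)

Definition mnm3 (x y z : nat) : 'X_{1..3} := [multinom nth 0%N [:: x; y; z] i | i < 3].

Lemma ord3_ind (P : 'I_3 -> Prop) : P 0 -> P 1 -> P 2 -> forall i, P i.
Proof.
move=> P0 P1 P2 i; have : [|| i == 0, i == 1 | i == 2].
  by case: i => [[|[|[|]]]].
by case/or3P => /eqP->.
Qed.

Lemma mnm3E x y z : (mnm3 x y z 0%R = x) * (mnm3 x y z 1%R = y) * (mnm3 x y z 2%R = z).
Proof. by rewrite !mnmE. Qed.

Lemma mdeg_mnm3 x y z : mdeg (mnm3 x y z) = (x + y + z)%N.
Proof. by rewrite mdegE !big_ord_recl big_ord0 !mnmE /= addn0 addnA. Qed.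

Lemma mdeg3 (m : 'X_{1..3}) : mdeg m = (m 0%R + m 1%R + m 2%R)%N.
Proof.
rewrite -[RHS]mdeg_mnm3; congr mdeg; apply/mnmP.
by apply: ord3_ind; rewrite mnm3E.
Qed.

Lemma lepm3 (u m : 'X_{1..3}) :
  (u <= m)%MM = [&& u 0%R <= m 0%R, u 1%R <= m 1%R & u 2%R <= m 2%R]%N.
Proof.
apply/mnm_lepP/and3P => [le|[le0 le1 le2]]; first by split.
exact: ord3_ind.
Qed.

Lemma I_gensE (k : fieldType) (a b c al be ga : nat) :
  I_gens k a b c al be ga =
  [seq 'X_[u] | u <- [:: mnm3 a 0 0; mnm3 0 b 0; mnm3 0 0 c;
                        mnm3 al 0 ga; mnm3 0 be ga]].
Proof.
rewrite /I_gens /= !mpolyXn -!mpolyXD.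
do ![congr cons]; congr mpolyX; apply/mnmP; apply: ord3_ind;
  by rewrite !(mnmDE, mulmnE, mnm1E, mnm3E) /= ?mul1n ?mul0n ?addn0.
Qed.

Definition span3 (a b c al be ga : nat) (m : 'X_{1..3}) : bool :=
  [&& m 0%R < a, m 1%R < b, m 2%R < c, (m 0%R < al) || (m 2%R < ga) &
      (m 1%R < be) || (m 2%R < ga)]%N.

Lemma I_gens_span (k : fieldType) (a b c al be ga : nat) (f : {mpoly k[3]}) :
  in_ideal (I_gens k a b c al be ga) f <->
  vanishes_on (span3 a b c al be ga) f.
Proof.
rewrite I_gensE in_ideal_monomials; split=> van m Dm; apply: van; move: Dm;
  by rewrite /span3 /= !lepm3 !mnm3E; lia.
Qed.

Lemma down_closed_span3 a b c al be ga : down_closed (span3 a b c al be ga).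
Proof. by move=> m u; rewrite lepm3 /span3; lia. Qed.

Ltac solve_mnm3 := rewrite /= /interval ?lepm3 ?mdeg3 ?mnm3E /span3; lia.

(** * The splittings of the monomials outside the ideal *)

Section ThreeVariables.
Context {k : fieldType} {a b c al be ga : nat}.
Context (char0 : [pchar k] =i pred0).
(** Equality [ga = c] is allowed because a shortened column may have height exactly [ga]. *)
Context (ha : (0 < al < a)%N) (hb : (0 < be < b)%N) (hc : (0 < ga <= c)%N).
Local Notation D := (span3 a b c al be ga).
Local Notation column := (interval (mnm3 0 0 0) (mnm3 al.-1 be.-1 c.-1)).
Local Notation inj := (@injective_on k 3).
Local Notation surj := (@surjective_on k 3).

(** The part [z >= ga] is the submodule. The 3 compensates for the three predecessors in each top
    corner. *)
Lemma injective_two_boxes i d : (ga < c)%N -> (i.*2 + d + 3 <= a + b + ga)%N ->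
  (i.*2 + d + 3 <= al + be + c + ga)%N -> inj D i d.
Proof.
move=> lt_c le1 le2.
apply: (@injective_onU _ _ _ (interval (mnm3 0 0 0) (mnm3 a.-1 b.-1 ga.-1))
                             (interval (mnm3 0 0 ga) (mnm3 al.-1 be.-1 c.-1))).
- by move=> m; solve_mnm3.
- by move=> m u; solve_mnm3.
- by apply: interval_injective => //; solve_mnm3.
- by apply: interval_injective => //; solve_mnm3.
Qed.

Lemma surjective_two_boxes i d : (ga < c)%N -> (a + b + ga <= i.*2 + d + 3)%N ->
  (al + be + c + ga <= i.*2 + d + 3)%N -> surj D i d.
Proof.
move=> lt_c le1 le2.
apply: (@surjective_onU _ _ _ (interval (mnm3 0 0 0) (mnm3 a.-1 b.-1 ga.-1))
                              (interval (mnm3 0 0 ga) (mnm3 al.-1 be.-1 c.-1))).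
- by move=> m; solve_mnm3.
- by move=> m u; solve_mnm3.
- by apply: interval_surjective => //; solve_mnm3.
- by apply: interval_surjective => //; solve_mnm3.
Qed.

(** Outside the column, [z < ga]; this region is cut along [x = al] for the first pair and along
    [y = be] for the second. *)
Let xbox := interval (mnm3 0 be 0) (mnm3 al.-1 b.-1 ga.-1).
Let xslab := interval (mnm3 al 0 0) (mnm3 a.-1 b.-1 ga.-1).
Let ybox := interval (mnm3 al 0 0) (mnm3 a.-1 be.-1 ga.-1).
Let yslab := interval (mnm3 0 be 0) (mnm3 a.-1 b.-1 ga.-1).

Lemma injective_three_boxes i d : (i.*2 + d + 3 <= al + be + c)%N ->
  (i.*2 + d + 3 <= al + be + b + ga)%N ->
  (i.*2 + d + 3 <= al + a + b + ga)%N -> inj D i d.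
Proof.
move=> le1 le2 le3; apply: (@injective_onU _ _ _ (predU column xbox) xslab).
- by rewrite /xbox /xslab => m; solve_mnm3.
- by rewrite /xbox /xslab => m u; solve_mnm3.
- apply: (@injective_onU _ _ _ column xbox) => //.
  + by rewrite /xbox => m u; solve_mnm3.
  + by apply: interval_injective => //; solve_mnm3.
  + by apply: interval_injective => //; solve_mnm3.
- by apply: interval_injective => //; solve_mnm3.
Qed.

Lemma surjective_three_boxes i d : (al + be + c <= i.*2 + d + 3)%N ->
  (al + be + b + ga <= i.*2 + d + 3)%N ->
  (al + a + b + ga <= i.*2 + d + 3)%N -> surj D i d.
Proof.
move=> le1 le2 le3; apply: (@surjective_onU _ _ _ (predU column xbox) xslab).
- by rewrite /xbox /xslab => m; solve_mnm3.
- by rewrite /xbox /xslab => m u; solve_mnm3.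
- apply: (@surjective_onU _ _ _ column xbox) => //.
  + by rewrite /xbox => m u; solve_mnm3.
  + by apply: interval_surjective => //; solve_mnm3.
  + by apply: interval_surjective => //; solve_mnm3.
- by apply: interval_surjective => //; solve_mnm3.
Qed.

Lemma injective_three_boxes_sym i d : (i.*2 + d + 3 <= al + be + c)%N ->
  (i.*2 + d + 3 <= al + be + a + ga)%N ->
  (i.*2 + d + 3 <= be + a + b + ga)%N -> inj D i d.
Proof.
move=> le1 le2 le3; apply: (@injective_onU _ _ _ (predU column ybox) yslab).
- by rewrite /ybox /yslab => m; solve_mnm3.
- by rewrite /ybox /yslab => m u; solve_mnm3.
- apply: (@injective_onU _ _ _ column ybox) => //.
  + by rewrite /ybox => m u; solve_mnm3.
  + by apply: interval_injective => //; solve_mnm3.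
  + by apply: interval_injective => //; solve_mnm3.
- by apply: interval_injective => //; solve_mnm3.
Qed.

Lemma surjective_three_boxes_sym i d : (al + be + c <= i.*2 + d + 3)%N ->
  (al + be + a + ga <= i.*2 + d + 3)%N ->
  (be + a + b + ga <= i.*2 + d + 3)%N -> surj D i d.
Proof.
move=> le1 le2 le3; apply: (@surjective_onU _ _ _ (predU column ybox) yslab).
- by rewrite /ybox /yslab => m; solve_mnm3.
- by rewrite /ybox /yslab => m u; solve_mnm3.
- apply: (@surjective_onU _ _ _ column ybox) => //.
  + by rewrite /ybox => m u; solve_mnm3.
  + by apply: interval_surjective => //; solve_mnm3.
  + by apply: interval_surjective => //; solve_mnm3.
- by apply: interval_surjective => //; solve_mnm3.
Qed.

(** The only monomial of degree 0 is 1, which lies in the column. *)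
Lemma injective_degree0 d : (d + 3 <= al + be + c)%N -> inj D 0 d.
Proof.
move=> le; apply: (@injective_onU _ _ _ column (predD D column)).
- by move=> m; solve_mnm3.
- by move=> m u; solve_mnm3.
- by apply: interval_injective => //; solve_mnm3.
- by apply: injective_on_deg => m; solve_mnm3.
Qed.

End ThreeVariables.

(** * Comparison of thresholds under the three conditions *)

(** No integer [2i + d] lies strictly between thresholds differing by at most 1. *)
Lemma max_rank_two_boxes (k : fieldType) (a b c al be ga i d : nat) :
  [pchar k] =i pred0 ->
  (0 < al < a)%N -> (0 < be < b)%N -> (0 < ga < c)%N ->
  (a + b <= al + be + c + 1)%N -> (al + be + c <= a + b + 1)%N ->
  @injective_on k 3 (span3 a b c al be ga) i d \/
  @surjective_on k 3 (span3 a b c al be ga) i d.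
Proof.
move=> char0 ha hb hc le1 le2; case: (leqP (i.*2 + d + 3) (a + b + ga)) => le3.
  case: (leqP (i.*2 + d + 3) (al + be + c + ga)) => le4.
    by left; apply: injective_two_boxes => //; lia.
all: by right; apply: surjective_two_boxes => //; lia.
Qed.

(** If [be = a] the thresholds of [xbox] and [xslab] coincide, and lie within 1 of the column's;
    [al = b] is the mirror case. *)
Lemma max_rank_three_boxes (k : fieldType) (a b c al be ga i d : nat) :
  [pchar k] =i pred0 ->
  (0 < al < a)%N -> (0 < be < b)%N -> (0 < ga < c)%N ->
  be = a \/ al = b -> (b + a + ga <= maxn al be + c + 1)%N ->
  (maxn al be + c <= b + a + ga + 1)%N ->
  @injective_on k 3 (span3 a b c al be ga) i d \/
  @surjective_on k 3 (span3 a b c al be ga) i d.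
Proof.
move=> char0 ha hb hc [def_be|def_al] le1 le2;
  case: (leqP (i.*2 + d + 3) (al + be + c)) => le3.
- case: (leqP (i.*2 + d + 3) (al + be + b + ga)) => le4.
    by left; apply: injective_three_boxes => //; lia.
  by right; apply: surjective_three_boxes => //; lia.
- by right; apply: surjective_three_boxes => //; lia.
- case: (leqP (i.*2 + d + 3) (al + be + a + ga)) => le4.
    by left; apply: injective_three_boxes_sym => //; lia.
  by right; apply: surjective_three_boxes_sym => //; lia.
- by right; apply: surjective_three_boxes_sym => //; lia.
Qed.

(** For surjectivity, cutting along the variable whose bound is 1 gives a slab threshold only 1
    above [a + b + ga - 3], which the strict inequality [gt1] absorbs. *)
Lemma max_rank_long_column (k : fieldType) (a b c al be ga i d : nat) :
  [pchar k] =i pred0 ->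
  (0 < al < a)%N -> (0 < be < b)%N -> (0 < ga < c)%N ->
  (minn al be = 1)%N -> (maxn al be = 2)%N -> (a + b + ga <= c + 2)%N ->
  @injective_on k 3 (span3 a b c al be ga) i d \/
  @surjective_on k 3 (span3 a b c al be ga) i d.
Proof.
move=> char0 ha hb hc min_1 max_2 le_c.
case: (leqP (i.*2 + d + 3) (a + b + ga)) => [le1|gt1].
  by left; apply: injective_two_boxes => //; lia.
case: i gt1 => [|i] gt1.
  case: (leqP d c) => [le_d|gt_d]; first by left; apply: injective_degree0 => //; lia.
  right; have [def_al|def_be] : (al = 1)%N \/ (be = 1)%N by lia.
    by apply: surjective_three_boxes => //; lia.
  by apply: surjective_three_boxes_sym => //; lia.
(* Shortening the column to the degrees at most i + d does not change the
   target of the map, but moves the centre of symmetry of the column down. *)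
right; apply: (@surjective_on_sub _ _ _
  (span3 a b (maxn ga (minn c (i.+1 + d).+1)) al be ga)).
- by move=> m; solve_mnm3.
- by move=> m; solve_mnm3.
have [def_al|def_be] : (al = 1)%N \/ (be = 1)%N by lia.
  by apply: surjective_three_boxes => //; lia.
by apply: surjective_three_boxes_sym => //; lia.
Qed.

Theorem theorem4p1 (k : fieldType) (a b c al be ga : nat) :
  [pchar k] =i pred0 ->
  (0 < al < a)%N -> (0 < be < b)%N -> (0 < ga < c)%N ->
  [\/ (al%:Z + be%:Z - 1 <= a%:Z + b%:Z - c%:Z <= al%:Z + be%:Z + 1),
      (minn al be != maxn al be /\ maxn al be = minn (al + be) (minn a b)
       /\ (maxn al be)%:Z - ga%:Z - 1 <= a%:Z + b%:Z - c%:Z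
          <= (maxn al be)%:Z - ga%:Z + 1)
    | ((minn al be < maxn al be <= 2)%N /\ (a + b + ga <= c + 2)%N)] ->
  has_SLP (in_ideal (I_gens k a b c al be ga)).
Proof.
move=> char0 ha hb hc cond; exists sum_vars; first exact: homog_sum_vars.
move=> d i _; apply: (max_rank_of_span (@I_gens_span k a b c al be ga)).
  exact: down_closed_span3.
case: cond => [c1|[_ [max_ab c2]]|[c3 le_c]].
- by apply: max_rank_two_boxes => //; lia.
(* As [al] and [be] are positive, their maximum is below [al + be], hence equals [minn a b]; with
   [al < a] and [be < b] this leaves [be = a] or [al = b]. *)
- by apply: max_rank_three_boxes => //; lia.
(* Positivity forces [al] and [be] to be 1 and 2 in some order. *)
- by apply: max_rank_long_column => //; lia.
Qed.
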